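(* Let $(\mathfrak g,A,\varphi)$ be a $7$-dimensional almost Abelian Lie algebra with $A\neq0$ and coclosed $\mathrm G_2$-structure $\varphi$ (so $A\in\mathfrak{sp}(\mathbb R^6)$), and let $\psi=*\varphi$. (i) $\psi$ is an algebraic soliton for the Laplacian coflow if and only if $$[[A,A^t]+S_A\circ_6S_A,\,A]=\frac{|[A,A^t]|^2+\langle S_A\circ_6S_A,[A,A^t]\rangle}{|A|^2}\,A .$$ In this case $D=Q_A-cI_7\in\operatorname{Der}(\mathfrak g,A)$ for $$c=-\frac12\Big(\operatorname{tr}S_A^2+\frac12(\operatorname{tr}JA)^2+\frac{|[A,A^t]|^2}{|A|^2}+\frac{\langle S_A\circ_6S_A,[A,A^t]\rangle}{|A|^2}\Big).$$ (ii) $\psi$ is a semi-algebraic soliton if and only if $$[A,A^t]+S_A\circ_6S_A=-\Big(\operatorname{tr}S_A^2+\frac12(\operatorname{tr}JA)^2+2d\Big)I_6+D_1+D_1^t$$ for some $D_1\in\mathfrak{gl}(\mathbb R^6)$ such that $[D_1,A]=dA$, where $$d=\frac{|[A,A^t]|^2+\langle S_A\circ_6S_A,[A,A^t]\rangle}{2|A|^2}.$$ In this case $Q_A=cI_7+\frac12(D+D^t)$, for some $D\in\operatorname{Der}(\mathfrak g,A)$, with the same value $$c=-\frac12\Big(\operatorname{tr}S_A^2+\frac12(\operatorname{tr}JA)^2+\frac{|[A,A^t]|^2}{|A|^2}+\frac{\langle S_A\circ_6S_A,[A,A^t]\rangle}{|A|^2}\Big).$$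
   Context: Almost Abelian setting: $\mathfrak g$ is a $7$-dimensional Lie algebra with an Abelian ideal $\mathfrak h\cong\mathbb R^6$ of codimension one, with a $\mathrm G_2$-structure which in an orthonormal basis $e_1,\dots,e_7$ with $\mathfrak h=\mathrm{span}(e_1,\dots,e_6)$ is $\varphi=\omega\wedge e^7+\rho^+$, where $\omega=e^{12}+e^{34}+e^{56}$, $\rho^+=e^{135}-e^{146}-e^{245}-e^{236}$. The dual form is $\psi=*\varphi=\frac12\omega^2+\rho^-\wedge e^7$ with $\rho^-=-e^{246}+e^{235}+e^{145}+e^{136}$, and $J$ is the complex structure on $\mathbb R^6$ with $\omega=\langle J\cdot,\cdot\rangle$. The bracket is encoded by $A=\mathrm{ad}(e_7)|_{\mathfrak h}\in\mathfrak{gl}(\mathbb R^6)$. The structure is coclosed ($\mathrm d\psi=0$) iff $A\in\mathfrak{sp}(\mathbb R^6)=\{A: AJ+JA^t=0\}$. Notation: $S_A=\frac12(A+A^t)$; $(S\circ_6S)_{ab}=S_{mn}S_{pq}\rho^+_{mpa}\rho^+_{nqb}$ (sum over repeated indices $1,\dots,6$); $\langle A,B\rangle=\operatorname{tr}(AB^t)$. For $B\in\mathfrak{gl}(\mathfrak g)$, $\theta(B)\psi=-\psi(B\cdot,\cdot,\cdot,\cdot)-\dots-\psi(\cdot,\cdot,\cdot,B\cdot)$. $Q_A$ is the symmetric endomorphism of $\mathfrak g$ with $\Delta_A\psi=\theta(Q_A)\psi$, where $\Delta_A$ is the Hodge Laplacian of $(\mathfrak g,A,\varphi)$ on left-invariant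 forms; explicitly $Q_A$ is block diagonal with respect to $\mathfrak h\oplus\mathbb R e_7$ with blocks $\frac12[A,A^t]+\frac12S_A\circ_6S_A$ and $-\frac12\operatorname{tr}S_A^2-\frac14(\operatorname{tr}JA)^2$. $\operatorname{Der}(\mathfrak g,A)$ denotes the derivations of $\mathfrak g$. $\psi$ is a semi-algebraic soliton if $Q_A=cI_7+\frac12(D+D^t)$ for some $c\in\mathbb R$ and $D\in\operatorname{Der}(\mathfrak g,A)$; it is an algebraic soliton if moreover $D^t\in\operatorname{Der}(\mathfrak g,A)$ (equivalently $Q_A=cI_7+D$ for some $c\in\mathbb R$, $D\in\operatorname{Der}(\mathfrak g,A)$). *)

(* Defs.v *)
From HB Require Import structures.
From mathcomp Require Import all_boot all_order all_algebra.
From mathcomp Require Import reals.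

Set Implicit Arguments.
Unset Strict Implicit.
Unset Printing Implicit Defensive.

Import Order.TTheory GRing.Theory Num.Theory.
Local Open Scope ring_scope.

(* The Lie algebra g is R^7 with its standard orthonormal basis e_1, ..., e_7;
   e_i is the (i-1)-st column of the identity matrix, h is spanned by the first
   six, and a vector is decomposed along g = h + R e_7 as a column of size
   6 + 1.  Endomorphisms act on columns from the left. *)

(* A k-form on R^n takes its k arguments as the columns of an n x k matrix. *)
Definition form (R : realType) (n k : nat) : Type := 'M[R]_(n, k) -> R.

Section Algebra.
Variable R : realType.

(* Elementary form e^{i_1 ... i_k} = e^{i_1} /\ ... /\ e^{i_k}, normalised by
   e^{i_1 ... i_k}(e_{i_1}, ..., e_{i_k}) = 1.  The indices are 1-based, as in
   e^{135}. *)
Definition eform {n k : nat} (I : k.-tuple nat) : form R n.+1 k :=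
  fun X => \det (rowsub (fun a : 'I_k => inord (tnth I a).-1) X).

Definition omega : form R 6 2 := fun X =>
  eform [tuple 1; 2]%N X + eform [tuple 3; 4]%N X + eform [tuple 5; 6]%N X.

Definition rho_plus : form R 6 3 := fun X =>
  eform [tuple 1; 3; 5]%N X - eform [tuple 1; 4; 6]%N X
  - eform [tuple 2; 4; 5]%N X - eform [tuple 2; 3; 6]%N X.

(* omega /\ e^7 + rho^+ *)
Definition phi : form R 7 3 := fun X =>
  eform [tuple 1; 2; 7]%N X + eform [tuple 3; 4; 7]%N X
  + eform [tuple 5; 6; 7]%N X
  + rho_plus (usubmx (X : 'M[R]_(6 + 1, 3))).

(* Basis vectors e_{I 0}, ..., e_{I (k-1)}, as columns. *)
Definition basis_cols {n k : nat} (I : 'I_k -> 'I_n) : 'M[R]_(n, k) :=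
  colsub I 1%:M.

(* omega(x, y) = <J x, y>, so that J_{ij} = <J e_j, e_i> = omega(e_j, e_i). *)
Definition J : 'M[R]_6 :=
  \matrix_(i, j) omega (basis_cols (tnth [tuple j; i])).

(* Hodge star for the standard metric and the orientation e^{1...7}:
   ( *alpha)(Y) = 1/k! sum_I alpha(e_I) vol(e_I, Y). *)
Definition hodge {k l : nat} (kl7 : (k + l = 7)%N) (alpha : form R 7 k) :
  form R 7 l := fun Y =>
  (k`!%:R)^-1 * \sum_(I : {ffun 'I_k -> 'I_7})
    alpha (basis_cols I) *
    \det (castmx (erefl 7, kl7) (row_mx (basis_cols I) Y)).

Definition psi : form R 7 4 := hodge (erefl : (3 + 4 = 7)%N) phi.

(* The bracket of (g, A): h is Abelian and ad(e_7) restricts to A on h. *)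
Definition bracket (A : 'M[R]_6) (x y : 'cV[R]_7) : 'cV[R]_7 :=
  let xh := usubmx (x : 'cV[R]_(6 + 1)) in
  let yh := usubmx (y : 'cV[R]_(6 + 1)) in
  let x7 := x ord_max 0 in
  let y7 := y ord_max 0 in
  col_mx (x7 *: (A *m yh) - y7 *: (A *m xh)) (0 : 'cV[R]_1).

Definition derivation (A : 'M[R]_6) (D : 'M[R]_7) : Prop :=
  forall x y : 'cV[R]_7,
    D *m bracket A x y = bracket A (D *m x) y + bracket A x (D *m y).

(* Chevalley-Eilenberg differential of left-invariant forms,
   (d alpha)(x_0, ..., x_m) = sum_(i < j) (-1)^(i + j)
     alpha([x_i, x_j], x_0, .., x_i omitted, .., x_j omitted, .., x_m).
   For i < j the index of x_i among the columns of col' j X is still i, and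
   lift j i has value i. *)
Definition diff (A : 'M[R]_6) {k : nat} (alpha : form R 7 k.+1) :
  form R 7 k.+2 := fun X =>
  \sum_(j < k.+2) \sum_(i < k.+1 | (i < j)%N)
    (-1) ^+ (i + j) *
    alpha (row_mx (bracket A (col (lift j i) X) (col j X))
                  (col' i (col' j X))).

Definition coclosed (A : 'M[R]_6) : Prop :=
  forall X : 'M[R]_(7, 5), diff A psi X = 0.

(* The codifferential on m-forms in dimension 7 is d^* = (-1)^m * d *. *)
Definition codiff (A : 'M[R]_6) {k l : nat} (e1 : (k.+1 + l.+1 = 7)%N)
    (e2 : (l.+2 + k = 7)%N) (alpha : form R 7 k.+1) : form R 7 k := fun X =>
  (-1) ^+ k.+1 * hodge e2 (diff A (hodge e1 alpha)) X.

(* Hodge Laplacian d d^* + d^* d on 4-forms. *)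
Definition laplacian (A : 'M[R]_6) (alpha : form R 7 4) : form R 7 4 :=
  fun X =>
  diff A (codiff A (erefl : (4 + 3 = 7)%N) (erefl : (4 + 3 = 7)%N) alpha) X
  + codiff A (erefl : (5 + 2 = 7)%N) (erefl : (3 + 4 = 7)%N)
      (diff A alpha) X.

Definition theta (B : 'M[R]_7) {k : nat} (alpha : form R 7 k) : form R 7 k :=
  fun X =>
  - \sum_(a < k)
      alpha (\matrix_(i, j) if j == a then (B *m X) i j else X i j).

(* Q = Q_A.  This determines Q uniquely: the stabiliser of psi in gl(g) is g_2,
   which consists of skew-symmetric endomorphisms. *)
Definition is_QA (A : 'M[R]_6) (Q : 'M[R]_7) : Prop :=
  Q^T = Q /\ forall X : 'M[R]_(7, 4), laplacian A psi X = theta Q psi X.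

Definition semi_algebraic_soliton (A : 'M[R]_6) (Q : 'M[R]_7) : Prop :=
  exists (c : R) (D : 'M[R]_7),
    derivation A D /\ Q = c%:M + 2^-1 *: (D + D^T).

Definition algebraic_soliton (A : 'M[R]_6) (Q : 'M[R]_7) : Prop :=
  exists (c : R) (D : 'M[R]_7),
    [/\ derivation A D, derivation A D^T & Q = c%:M + 2^-1 *: (D + D^T)].

Definition symp (A : 'M[R]_6) : 'M[R]_6 := 2^-1 *: (A + A^T).

Definition rho_plus_coef (i j k : 'I_6) : R :=
  rho_plus (basis_cols (tnth [tuple i; j; k])).

Definition circ6 (S : 'M[R]_6) : 'M[R]_6 := \matrix_(a, b)
  \sum_m \sum_n \sum_p \sum_q
    S m n * S p q * rho_plus_coef m p a * rho_plus_coef n q b.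

Definition commutator (A B : 'M[R]_6) : 'M[R]_6 := A *m B - B *m A.

Definition inner (A B : 'M[R]_6) : R := \tr (A *m B^T).

Definition normsq (A : 'M[R]_6) : R := inner A A.

Definition soliton_const (A : 'M[R]_6) : R :=
  let S := symp A in
  let L := commutator A A^T in
  - (2^-1 * (\tr (S *m S) + 2^-1 * (\tr (J *m A)) ^+ 2
             + normsq L / normsq A + inner (circ6 S) L / normsq A)).

End Algebra.

Arguments J {R}.
Arguments phi {R}.
Arguments psi {R}.

(* Main.v *)
From mathcomp Require Import fingroup perm.
Require Import Defs.
From HB Require Import structures.
From mathcomp Require Import all_boot all_order all_algebra.
From mathcomp Require Import reals ring lra zify.

Set Implicit Arguments.
Unset Strict Implicit.
Unset Printing Implicit Defensive.

Import Order.TTheory GRing.Theory Num.Theory.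
Local Open Scope ring_scope.

(** Both parts of the theorem follow from two facts: the explicit form of Q_A,
    and the shape of the derivations of an almost Abelian Lie algebra.

    Form of Q_A. On left-invariant forms d alpha = e^7 /\ theta(A) alpha, where
    theta(A) only acts on h. As psi is closed, its Laplacian is
    d d^* psi = d * d phi, which is - (theta(A) * theta(A) rho^+) /\ e^7 with
    the star of R^6. Split A in sp(R^6) as S + K, where S is symmetric and
    anticommutes with J, and K is skew and commutes with J. With
    l = tr(JA) / 2, these parts act by
      theta(K) rho^+ = - l rho^-,  theta(K) rho^- = l rho^+,
      * theta(S) rho^+ = - theta(S) rho^-,
      theta(S) theta(S) rho^- = theta(S o S / 2) rho^- + (|S|^2 / 2) rho^-,
    and [K, S] = [A, A^t] / 2. Hence, the terms l theta(S) rho^+ cancelling,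
    - theta(A) * theta(A) rho^+ = theta(([A, A^t] + S o S) / 2) rho^-
                                  + (|S|^2 / 2 + l^2) rho^-,
    and this is the e^7-part of theta(Q) psi for the block diagonal Q with
    blocks ([A, A^t] + S o S) / 2 and - |S|^2 / 2 - l^2. The other part of
    theta(Q) psi vanishes because the first block lies in sp(R^6). A symmetric
    endomorphism is determined by its action on psi (theta_psi_inj), so Q is
    the Q of the theorem (QA_block). Here the identity is checked
    coefficientwise, by exterior calculus in coordinates: hodge_wedge,
    diff_wedge and theta_wedge give the three operators on elementary forms,
    hence on lists that represent combinations of elementary forms with
    monomials in the entries of A as coefficients. The 35 coefficients of the
    two sides are then computed, and agree as polynomials once the 15 linear
    equations of sp(R^6) are substituted (QA_laplacian).

    Solitons. The h-block D1 of a derivation D satisfies [D1, A] = delta A, with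
    delta the last diagonal entry of D, and conversely such a pair (D1, delta)
    defines a block diagonal derivation. Pairing with A gives
    delta |A|^2 = <D1, [A, A^t]>. Since [A, A^t] is symmetric and traceless,
    this only sees the symmetric part of D1 up to multiples of the identity,
    which the soliton equation prescribes through the first block of Q_A: so
    delta is the number d of the theorem. The corner of the soliton equation
    then reads c = Q_77 - d. What remains is to compare blocks; in the algebraic
    case, averaging D and D^t shows that the first block of Q_A itself satisfies
    the commutator equation. *)

(** * Determinants *)

Definition skip (j : nat) (I : seq nat) := take j I ++ drop j.+1 I.

Lemma nth_skip (I : seq nat) j b : (j < size I)%N ->
  nth 0%N (skip j I) b = nth 0%N I (bump j b).
Proof.
move=> jI; rewrite /skip nth_cat size_take jI /bump [(j <= b)%N]leqNgt.
case: ltnP => bj /=; first by rewrite nth_take.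
by rewrite nth_drop add1n; congr nth; lia.
Qed.

Lemma size_skip (I : seq nat) j : (j < size I)%N -> size (skip j I) = (size I).-1.
Proof. by move=> jI; rewrite size_cat size_take size_drop jI; lia. Qed.

(** The generalised Kronecker delta: for K and I of the same length, the
    determinant of the matrix with entries delta_(K_a, I_b), by expansion along
    the first row. *)
Fixpoint kron (K I : seq nat) : int :=
  if K is x :: K' then
    foldr (fun j s => (if x == nth 0%N I j then
       (if odd j then - kron K' (skip j I) else kron K' (skip j I)) + s else s))
       0 (iota 0 (size I))
  else 1.

Lemma kronE (R : comNzRingType) k (K I : seq nat) : size K = k -> size I = k ->
  \det (\matrix_(a < k, b < k) (nth 0%N K a == nth 0%N I b)%:R) =
  (kron K I)%:~R :> R.
Proof.
elim: k K I => [|k IH] [|x K] // I /=; first by rewrite det_mx00.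
case=> sK sI; rewrite (expand_det_row _ ord0) sI.
rewrite -[RHS]/((foldr _ _ _)%:~R : R).
rewrite [RHS](_ : _ = \sum_(j <- iota 0 k.+1) (x == nth 0%N I j)%:R *
   ((-1) ^+ j * (kron K (skip j I))%:~R)); last first.
  elim: (iota 0 k.+1) => [|j s IHs]; first by rewrite big_nil.
  rewrite big_cons -IHs /= -signr_odd.
  case: (x == _) => /=; last by rewrite mul0r add0r.
  by case: (odd j); rewrite mul1r ?expr1 ?expr0 intrD ?intrN ?mulN1r ?mul1r.
have -> : iota 0 k.+1 = index_iota 0 k.+1 by rewrite /index_iota subn0.
rewrite big_mkord.
apply: eq_bigr => j _; rewrite !mxE /=; congr (_ * _).
rewrite /cofactor add0n; congr (_ * _).
have jI : (j < size I)%N by rewrite sI.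
rewrite -IH ?size_skip ?sI //; congr (\det _).
by apply/matrixP => a b; rewrite !mxE /= nth_skip.
Qed.

(** Laplace expansion along the first two rows. The pair of columns i < j is
    indexed as in the differential: j is deleted first, so that the smaller
    index keeps its value. *)
Lemma det_two_rows (R : comNzRingType) k (M : 'M[R]_(k.+2)) :
  \det M = \sum_(j < k.+2) \sum_(i < k.+1 | (i < j)%N)
    (-1) ^+ (i + j) *
    (M 0 j * M (lift 0 0) (lift j i) - M 0 (lift j i) * M (lift 0 0) j) *
    \det (col' i (col' j (row' 0 (row' 0 M)))).
Proof.
pose m (j : 'I_k.+2) (i : 'I_k.+1) := \det (col' i (col' j (row' 0 (row' 0 M)))).
pose G (j : 'I_k.+2) (i : 'I_k.+1) :=
  (-1) ^+ (i + j) * (M 0 j * M (lift 0 0) (lift j i)) * m j i.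
pose H (j : 'I_k.+2) (i : 'I_k.+1) :=
  (-1) ^+ (i + j) * (M 0 (lift j i) * M (lift 0 0) j) * m j i.
have -> : \det M = \sum_(j < k.+2) \sum_(i < k.+1) G j i.
  rewrite (expand_det_row _ 0); apply: eq_bigr => j _.
  rewrite /cofactor (expand_det_row _ 0) !mulr_sumr; apply: eq_bigr => i _.
  rewrite !mxE /cofactor /= !add0n /G exprD.
  rewrite (_ : \det _ = m j i); first by ring.
  by congr (\det _); apply/matrixP => a b; rewrite !mxE.
transitivity (\sum_(j < k.+2) \sum_(i < k.+1 | (i < j)%N) G j i -
              \sum_(j < k.+2) \sum_(i < k.+1 | (i < j)%N) H j i); last first.
  rewrite -sumrB; apply: eq_bigr => j _; rewrite -sumrB.
  by apply: eq_bigr => i _; rewrite /G /H -/(m j i); ring.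
transitivity (\sum_(j < k.+2) (\sum_(i < k.+1 | (i < j)%N) G j i +
                               \sum_(i < k.+1 | ~~ (i < j)%N) G j i)).
  by apply: eq_bigr => j _; apply: bigID.
rewrite big_split /=; congr (_ + _); rewrite -sumrN /=.
(* The terms in which the second row uses a column to the right of j give the
   negative minors, once the two columns are exchanged. *)
rewrite (exchange_big_dep predT) //= [RHS]big_ord_recl.
rewrite [X in - X + _]big1 // oppr0 add0r.
apply: eq_bigr => i _; rewrite -sumrN big_mkcond [RHS]big_mkcond.
rewrite big_ord_recr /= ltn_ord addr0; apply: eq_bigr => j _.
rewrite -leqNgt -[(j < bump 0 i)%N]/(j <= i)%N; case: leqP => // ji.
have e1 : lift (widen_ord (leqnSn k.+1) j) i = lift 0 i.
  by apply/val_inj; rewrite /= /bump ji.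
have e2 : lift (lift 0 i) j = widen_ord (leqnSn k.+1) j.
  by apply/val_inj; rewrite /= /bump; lia.
rewrite /G /H e1 e2.
have -> : m (widen_ord (leqnSn k.+1) j) i = m (lift 0 i) j.
  rewrite /m; congr (\det _); apply/matrixP => a b; rewrite !mxE.
  by congr (M _ _); apply/val_inj; rewrite /= /bump; lia.
rewrite [nat_of_ord (lift 0 i)]/= /bump [nat_of_ord (widen_ord _ _)]/= add1n.
rewrite addnS exprS addnC.
by ring.
Qed.

(** * Elementary forms *)

(** Index lists are 1-based, as in e^{135}; idx i is the i-th coordinate. *)
Definition idx {n : nat} (i : nat) : 'I_n.+1 := inord i.-1.

Definition in_range (n : nat) (K : seq nat) := all (fun i => 0 < i <= n)%N K.

Lemma idxS n (i : 'I_n.+1) : idx i.+1 = i.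
Proof. exact: inord_val. Qed.

Lemma idx_eq n i j : (0 < i <= n.+1)%N -> (0 < j <= n.+1)%N ->
  (idx i == idx j :> 'I_n.+1) = (i == j).
Proof.
by case: i j => [|i] [|j] //= hi hj; rewrite -val_eqE /= !inordK.
Qed.

Section Wedge.
Variable R : realType.

Lemma sum_iota0 n (F : nat -> R) : \sum_(i <- iota 0 n) F i = \sum_(i < n) F i.
Proof. by rewrite -(big_mkord xpredT) /index_iota subn0. Qed.

Lemma sum_iota1 n (F : nat -> R) :
  \sum_(i <- iota 1 n) F i = \sum_(i < n) F i.+1.
Proof. by rewrite -[1%N]addn0 iotaDl big_map sum_iota0. Qed.

(** The elementary form e^{i_1 ... i_k} of the list K = [:: i_1; ...; i_k].
    Repeated indices are allowed, and give the zero form. *)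
Definition wedge {n : nat} (k : nat) (K : seq nat) : Defs.form R n.+1 k :=
  fun X => \det (\matrix_(a < k, b < k) X (idx (nth 0%N K a)) b).

Lemma eform_wedge n k (K : k.-tuple nat) (X : 'M[R]_(n.+1, k)) :
  eform K X = wedge K X.
Proof.
by congr (\det _); apply/matrixP => a b; rewrite !mxE (tnth_nth 0%N).
Qed.

Definition basisL {n : nat} (k : nat) (I : seq nat) : 'M[R]_(n.+1, k) :=
  basis_cols R (fun b : 'I_k => idx (nth 0%N I b)).

Lemma wedge_basis n k (K I : seq nat) : size K = k -> size I = k ->
  in_range n.+1 K -> in_range n.+1 I ->
  wedge K (basisL k I : 'M[R]_(n.+1, k)) = (kron K I)%:~R.
Proof.
move=> sK sI /allP rK /allP rI; rewrite -(@kronE _ k) //.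
congr (\det _); apply/matrixP => a b; rewrite !mxE -/(idx _) idx_eq //.
  by apply: rK; rewrite mem_nth ?sK.
by apply: rI; rewrite mem_nth ?sI.
Qed.

Lemma det_col_perm_row_mx n k l (kl : (k + l = n)%N) (Z : 'M[R]_(n, k)) Y
    (s : 'S_k) :
  \det (castmx (erefl n, kl) (row_mx (col_perm s Z) Y)) =
  (-1) ^+ s * \det (castmx (erefl n, kl) (row_mx Z Y)).
Proof.
case: n / kl Z Y => Z Y; rewrite !castmx_id.
have -> : row_mx (col_perm s Z) Y =
    row_mx Z Y *m block_mx (perm_mx s^-1) 0 0 1%:M.
  by rewrite mul_row_block !mulmx0 mulmx1 addr0 add0r col_permE.
by rewrite det_mulmx det_ublock det1 mulr1 det_perm odd_permV mulrC.
Qed.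

(** Up to permutation, the only basis vectors contributing to the Hodge star of
    e^K are e_{K_1}, ..., e_{K_k}; the k! permutations give equal terms. *)
Lemma hodge_wedge_det k l (kl : (k + l = 7)%N) (K : seq nat) (Y : 'M[R]_(7, l)) :
  hodge kl (wedge K) Y = \det (castmx (erefl 7, kl) (row_mx (basisL k K) Y)).
Proof.
pose F (I : 'I_k -> 'I_7) :=
  \det (castmx (erefl 7, kl) (row_mx (basis_cols R I) Y)).
pose kap (a : 'I_k) : 'I_7 := idx (nth 0%N K a).
rewrite /hodge -[RHS]/(F kap).
have -> : \sum_(I : {ffun 'I_k -> 'I_7}) wedge K (basis_cols R I) * F I =
    \sum_(s : 'S_k) F kap.
  under eq_bigr do rewrite /wedge /determinant mulr_suml.
  rewrite exchange_big; apply: eq_bigr => s _ /=.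
  (* For each s, only the tuple of the indices of K permuted by s^-1 survives. *)
  rewrite (bigD1 [ffun a => kap (s^-1%g a)]) //= [X in _ + X]big1 ?addr0.
    rewrite big1 ?mulr1; last by move=> a _; rewrite !mxE ffunE permK eqxx.
    have -> : F [ffun a => kap (s^-1%g a)] = (-1) ^+ s * F kap.
      rewrite /F -odd_permV -det_col_perm_row_mx.
      congr (\det (castmx _ (row_mx _ _))).
      by apply/matrixP => i b; rewrite !mxE ffunE.
    by rewrite mulrA -expr2 sqrr_sign mul1r.
  move=> I nI; have [a ha] : exists a, kap a != I (s a).
    apply/existsP; apply: contraR nI => /existsPn h; apply/eqP/ffunP => b.
    by rewrite ffunE; have := h (s^-1%g b); rewrite permKV negbK => /eqP.
  by rewrite (bigD1 a) //= !mxE (negbTE ha) mul0r mulr0 mul0r.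
rewrite sumr_const card_Sn -[F kap *+ _]mulr_natl mulrA mulVf ?mul1r //.
by rewrite pnatr_eq0 -lt0n fact_gt0.
Qed.

(** When the leading columns are basis vectors, permuting the rows by s makes
    the matrix block triangular with an identity block. *)
Lemma det_row_mx_basis n k l (kl : (k + l = n)%N) (kap : 'I_k -> 'I_n)
    (kap' : 'I_l -> 'I_n) (s : 'S_n) (Y : 'M[R]_(n, l)) :
    (forall a, s (cast_ord kl (lshift l a)) = kap a) ->
    (forall b, s (cast_ord kl (rshift k b)) = kap' b) ->
  \det (castmx (erefl n, kl) (row_mx (basis_cols R kap) Y)) =
  (-1) ^+ s * \det (rowsub kap' Y).
Proof.
case: n / kl kap kap' s Y => kap kap' s Y hk hk'.
have {}hk a : s (lshift l a) = kap a by rewrite -hk cast_ord_id.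
have {}hk' b : s (rshift k b) = kap' b by rewrite -hk' cast_ord_id.
rewrite castmx_id; set M := row_mx _ _.
have kap_inj : injective kap.
  by move=> a b; rewrite -!hk => /perm_inj/lshift_inj.
have kap_neq a b : kap' a == kap b = false.
  by rewrite -hk -hk' (inj_eq perm_inj) eq_rlshift.
have <- : \det (row_perm s M) = \det (rowsub kap' Y).
  have -> : row_perm s M = block_mx 1%:M (rowsub kap Y) 0 (rowsub kap' Y).
    apply/matrixP => i j; rewrite mxE.
    case: (split_ordP i) => a ->; case: (split_ordP j) => b ->.
    - by rewrite hk row_mxEl block_mxEul !mxE (inj_eq kap_inj).
    - by rewrite hk row_mxEr block_mxEur !mxE.
    - by rewrite hk' row_mxEl block_mxEdl !mxE kap_neq.
    - by rewrite hk' row_mxEr block_mxEdr !mxE.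
  by rewrite det_ublock det1 mul1r.
by rewrite row_permE det_mulmx det_perm mulrA -expr2 sqrr_sign mul1r.
Qed.

Definition compl (K : seq nat) := [seq i <- iota 1 7 | i \notin K].

Lemma hodge_wedge k l (kl : (k + l = 7)%N) (K : seq nat) (Y : 'M[R]_(7, l)) :
  size K = k -> uniq K -> in_range 7 K ->
  hodge kl (wedge K) Y =
  (kron (K ++ compl K) (iota 1 7))%:~R * wedge (compl K) Y.
Proof.
move=> sK uK rK; set KK := K ++ compl K.
have pKK : perm_eq KK (iota 1 7).
  apply: uniq_perm; rewrite ?iota_uniq //.
    rewrite cat_uniq uK filter_uniq ?iota_uniq // andbT.
    by apply/hasPn => i; rewrite mem_filter => /andP[].
  move=> i; rewrite mem_cat mem_filter mem_iota.
  case: (boolP (i \in K)) => //= iK.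
  by have := allP rK _ iK; rewrite add1n ltnS => ->.
have sKK : size KK = 7%N by rewrite (perm_size pKK) size_iota.
have rKK (a : 'I_7) : (0 < nth 0%N KK a <= 7)%N.
  have : nth 0%N KK a \in iota 1 7 by rewrite -(perm_mem pKK) mem_nth ?sKK.
  by rewrite mem_iota add1n ltnS.
pose f (a : 'I_7) : 'I_7 := idx (nth 0%N KK a).
have f_inj : injective f.
  move=> a b /eqP; rewrite /f idx_eq // nth_uniq ?sKK //.
    by move=> /eqP/val_inj.
  by rewrite (perm_uniq pKK) iota_uniq.
rewrite hodge_wedge_det (@det_row_mx_basis _ _ _ _ _
  (fun b => idx (nth 0%N (compl K) b)) (perm f_inj)).
- congr (_ * _); rewrite -(@kronE _ 7) ?size_iota // -det_perm; congr (\det _).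
  apply/matrixP => a b; rewrite !mxE permE nth_iota // add1n -{1}[b]idxS.
  by rewrite idx_eq // ltnS ltn_ord.
- by move=> a; rewrite permE /f nth_cat sK /= ltn_ord.
- by move=> b; rewrite permE /f nth_cat sK /= ltnNge leq_addr /= addKn.
Qed.

Definition ent {n m : nat} (M : 'M[R]_(n.+1, m.+1)) (i j : nat) : R :=
  M (idx i) (idx j).

Lemma idx_lshift i : (0 < i <= 6)%N -> (idx i : 'I_7) = lshift 1 (idx i : 'I_6).
Proof. by case: i => // i hi; apply: val_inj; rewrite /= !inordK //=; lia. Qed.

Lemma idx7 : (idx 7 : 'I_7) = rshift 6 (0 : 'I_1).
Proof. by apply: val_inj; rewrite /= inordK. Qed.

Lemma bracket_idx (A : 'M[R]_6) (x y : 'cV[R]_7) i : (0 < i <= 7)%N ->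
  bracket A x y (idx i) 0 = (i != 7%N)%:R * \sum_(q < 6) ent A i q.+1 *
    (x (idx 7) 0 * y (idx q.+1) 0 - y (idx 7) 0 * x (idx q.+1) 0).
Proof.
have e7 : (ord_max : 'I_7) = idx 7 by apply: val_inj; rewrite /= inordK.
case: eqVneq => [-> _|i7 hi]; rewrite /bracket.
  by rewrite idx7 (@col_mxEd _ 6 1 1) mxE mul0r.
rewrite idx_lshift; last lia.
rewrite (@col_mxEu _ 6 1 1) !mxE mul1r !mulr_sumr -sumrB; apply: eq_bigr => q _.
have hq : idx q.+1 = lshift 1 q :> 'I_7 by rewrite idx_lshift ?idxS //=.
by rewrite !mxE /ent idxS e7 hq; ring.
Qed.

Lemma row_mx_col0 n k (b : 'cV[R]_n) (Z : 'M[R]_(n, k)) i :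
  row_mx b Z i (0 : 'I_k.+1) = b i 0.
Proof.
have -> : (0 : 'I_k.+1) = lshift k (0 : 'I_1) by apply: val_inj.
by rewrite row_mxEl.
Qed.

Lemma row_mx_colS n k (b : 'cV[R]_n) (Z : 'M[R]_(n, k)) i (j : 'I_k) :
  row_mx b Z i (lift 0 j : 'I_k.+1) = Z i j.
Proof.
have -> : (lift 0 j : 'I_k.+1) = rshift 1 j by apply: val_inj.
by rewrite row_mxEr.
Qed.

(** The rule d e^K = - sum_a (-1)^a e^7 /\ theta_a /\ e^{K minus K_a} with
    theta_a = sum_q A_(K_a, q) e^q: for covectors, d e^i = - e^7 /\ theta_i and
    d e^7 = 0. The differential pairs [x_i, x_j] with minors of the remaining
    vectors, and this is a Laplace expansion along the rows e^7 and theta_a. *)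
Lemma diff_wedge (A : 'M[R]_6) k (K : seq nat) (X : 'M[R]_(7, k.+2)) :
  size K = k.+1 -> in_range 7 K ->
  diff A (wedge K) X =
  \sum_(a <- iota 0 k.+1 | nth 0%N K a != 7%N) \sum_(q <- iota 1 6)
    (-1) ^+ a.+1 * ent A (nth 0%N K a) q * wedge [:: 7, q & skip a K]%N X.
Proof.
move=> sK /allP rK; rewrite big_mkcond sum_iota0.
pose m a (j : 'I_k.+2) (i : 'I_k.+1) : R := \det (col' i (col' j
  (\matrix_(c < k, b < k.+2) X (idx (nth 0%N (skip a K) c)) b))).
pose x q j := X (idx q) j.
transitivity (\sum_(j < k.+2) \sum_(i < k.+1 | (i < j)%N)
  \sum_(a < k.+1) \sum_(q < 6)
   (-1) ^+ a.+1 * ((nth 0%N K a != 7%N)%:R * ent A (nth 0%N K a) q.+1) *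
  ((-1) ^+ (i + j) *
    (x 7%N j * x q.+1 (lift j i) - x 7%N (lift j i) * x q.+1 j) * m a j i)).
  apply: eq_bigr => j _; apply: eq_bigr => i _.
  rewrite /wedge (expand_det_col _ 0) mulr_sumr; apply: eq_bigr => a _.
  rewrite mxE row_mx_col0 -/(idx _).
  rewrite bracket_idx; last by apply: rK; rewrite mem_nth ?sK.
  rewrite mulr_sumr !mulr_suml mulr_sumr; apply: eq_bigr => q _.
  rewrite /cofactor (_ : \det _ = m a j i).
    by rewrite /x !mxE addn0 exprS; ring.
  congr (\det _); apply/matrixP => c b.
  rewrite [LHS]mxE [LHS]mxE [LHS]mxE row_mx_colS !mxE.
  by rewrite nth_skip ?sK.
under eq_bigr do rewrite exchange_big; rewrite exchange_big.
apply: eq_bigr => a _; case: ifP => [_|_]; last first.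
  by rewrite big1 // => j _; rewrite big1 // => i _; rewrite big1 // => q _;
    rewrite mul0r mulr0 mul0r.
rewrite sum_iota1.
under eq_bigr do rewrite exchange_big; rewrite exchange_big.
apply: eq_bigr => q _; rewrite mul1r /wedge det_two_rows mulr_sumr.
apply: eq_bigr => j _; rewrite mulr_sumr; apply: eq_bigr => i _.
rewrite -!mulrA; congr (_ * _).
rewrite !mxE /m; congr (_ * (_ * (_ * _))); congr (\det _).
by apply/matrixP => c b; rewrite !mxE.
Qed.

(** Replacing a column x_a by B x_a, summed over all columns, equals replacing a
    row e^{K_a} by its composition with B, summed over all rows: both are the sum
    over the cofactors of the matrix. *)
Lemma theta_wedge (B : 'M[R]_7) k (K : seq nat) (X : 'M[R]_(7, k)) :
  size K = k ->
  theta B (wedge K) X = - \sum_(a <- iota 0 k) \sum_(q <- iota 1 7)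
    ent B (nth 0%N K a) q * wedge (set_nth 0%N K a q) X.
Proof.
move=> sK; congr (- _); rewrite sum_iota0.
pose M := \matrix_(a < k, b < k) X (idx (nth 0%N K a)) b.
have BXE i j : (B *m X) i j = \sum_(q <- iota 1 7) B i (idx q) * X (idx q) j.
  by rewrite mxE sum_iota1; apply: eq_bigr => q _; rewrite idxS.
transitivity (\sum_(a < k) \sum_(c < k)
    (B *m X) (idx (nth 0%N K c)) a * cofactor M c a).
  apply: eq_bigr => a _; rewrite /wedge (expand_det_col _ a).
  apply: eq_bigr => c _; rewrite mxE [X in X * _]mxE eqxx; congr (_ * (_ * \det _)).
  by apply/matrixP => i j; rewrite !mxE eq_sym (negbTE (neq_lift _ _)).
rewrite exchange_big; apply: eq_bigr => c _.
under eq_bigr do rewrite BXE mulr_suml.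
rewrite exchange_big; apply: eq_bigr => q _.
rewrite /wedge (expand_det_row _ c) mulr_sumr; apply: eq_bigr => b _.
rewrite -mulrA !mxE nth_set_nth /= eqxx; congr (_ * (_ * (_ * \det _))).
apply/matrixP => i j; rewrite !mxE nth_set_nth /=.
by rewrite eq_sym (negbTE (neq_bump _ _)).
Qed.

End Wedge.

(** * Exterior calculus on lists *)

(** A monomial is an integer coefficient with a list of entry positions (i, j),
    and an eterm is a monomial times an elementary form. Lists of eterms are
    formal sums; they contain no real numbers, so that the operators below can
    be evaluated on them. *)
Definition monomial := (int * seq (nat * nat))%type.
Definition eterm := (monomial * seq nat)%type.

Definition scale_mon (c : int) (u : monomial) : monomial := (c * u.1, u.2).
Definition mul_entry (i j : nat) (u : monomial) : monomial :=
  (u.1, (i, j) :: u.2).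

Definition hodgeL (l : seq eterm) : seq eterm :=
  [seq (scale_mon (kron (t.2 ++ compl t.2) (iota 1 7)) t.1, compl t.2) | t <- l].

(** Terms with a repeated index are dropped, which keeps the index lists in the
    domain of hodgeL. *)
Definition diffL (l : seq eterm) : seq eterm :=
  [seq t <- flatten [seq flatten [seq [seq
     (scale_mon ((-1) ^+ a.+1) (mul_entry (nth 0%N t.2 a) q t.1),
       [:: 7, q & skip a t.2]%N) | q <- iota 1 6]
      | a <- iota 0 (size t.2) & nth 0%N t.2 a != 7%N] | t <- l] | uniq t.2].

Definition thetaL (l : seq eterm) : seq eterm :=
  flatten [seq flatten [seq [seq
     (scale_mon (-1) (mul_entry (nth 0%N t.2 a) q t.1),
       set_nth 0%N t.2 a q) | q <- iota 1 7]
      | a <- iota 0 (size t.2)] | t <- l].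

Definition coefL (I : seq nat) (l : seq eterm) : seq monomial :=
  [seq u <- [seq scale_mon (kron t.2 I) t.1 | t <- l] | u.1 != 0].

Definition wfL n k (l : seq eterm) :=
  all (fun t => (size t.2 == k) && in_range n t.2) l.

Section Evaluation.
Variable R : realType.
Implicit Types (a : nat -> nat -> R).

Definition mon_val a (u : monomial) : R := u.1%:~R * \prod_(p <- u.2) a p.1 p.2.
Definition poly_val a (s : seq monomial) : R := \sum_(u <- s) mon_val a u.
Definition ev n a k (l : seq eterm) : Defs.form R n.+1 k :=
  fun X => \sum_(t <- l) mon_val a t.1 * wedge t.2 X.

Lemma mon_val_scale a c u : mon_val a (scale_mon c u) = c%:~R * mon_val a u.
Proof. by rewrite /mon_val intrM mulrA. Qed.

Lemma mon_val_mul a i j u : mon_val a (mul_entry i j u) = a i j * mon_val a u.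
Proof. by rewrite /mon_val big_cons /= mulrCA. Qed.

Lemma ev_basis n a k (l : seq eterm) (I : seq nat) :
  wfL n.+1 k l -> size I = k -> in_range n.+1 I ->
  ev (n := n) a l (basisL R k I) = poly_val a (coefL I l).
Proof.
move=> /allP wl sI rI; rewrite /ev /poly_val big_filter big_map /=.
rewrite [RHS]big_mkcond !big_seq; apply: eq_bigr => t /wl /andP[/eqP st rt].
rewrite wedge_basis // mon_val_scale mulrC.
by case: eqP => //= h; rewrite -mon_val_scale /mon_val /= h mul0r.
Qed.

Lemma hodge_ext k l (kl : (k + l = 7)%N) (f g : Defs.form R 7 k) Y :
  f =1 g -> hodge kl f Y = hodge kl g Y.
Proof. by move=> fg; congr (_ * _); apply: eq_bigr => I _; rewrite fg. Qed.

Lemma diff_ext A k (f g : Defs.form R 7 k.+1) X :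
  f =1 g -> diff A f X = diff A g X.
Proof. by move=> fg; do 2![apply: eq_bigr => ? _]; rewrite fg. Qed.

Lemma hodge_ev a k l (kl : (k + l = 7)%N) (s : seq eterm) Y :
  wfL 7 k s -> all (fun t => uniq t.2) s ->
  hodge kl (ev a s) Y = ev a (hodgeL s) Y.
Proof.
move=> /allP ws /allP us; rewrite /hodge /ev big_map.
transitivity (\sum_(t <- s) mon_val a t.1 * hodge kl (wedge t.2) Y); last first.
  rewrite !big_seq; apply: eq_bigr => t ts; have /andP[/eqP st rt] := ws t ts.
  by rewrite hodge_wedge ?us // mon_val_scale mulrCA mulrA.
under eq_bigr do rewrite mulr_suml.
rewrite exchange_big mulr_sumr; apply: eq_bigr => t _ /=.
rewrite /hodge [RHS]mulrCA; congr (_ * _); rewrite mulr_sumr.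
by apply: eq_bigr => I _; rewrite mulrA.
Qed.

Lemma wedge_nuniq n k (K : seq nat) (X : 'M[R]_(n.+1, k)) :
  size K = k -> ~~ uniq K -> wedge K X = 0.
Proof.
move=> sK /(uniqPn 0%N)[i [j [ij jK e]]]; rewrite sK in jK.
apply: (@determinant_alternate _ _ _ (Ordinal (ltn_trans ij jK)) (Ordinal jK)).
  by rewrite -val_eqE /= neq_ltn ij.
by move=> b; rewrite !mxE /= e.
Qed.

Lemma diff_ev A k (s : seq eterm) X : wfL 7 k.+1 s ->
  diff A (ev (ent A) s) X = ev (ent A) (k := k.+2) (diffL s) X.
Proof.
move=> /allP ws; rewrite /diffL /ev big_filter big_flatten big_map.
transitivity (\sum_(t <- s) mon_val (ent A) t.1 * diff A (wedge t.2) X).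
  transitivity (\sum_(j < k.+2) \sum_(i < k.+1 | (i < j)%N) \sum_(t <- s)
    mon_val (ent A) t.1 * ((-1) ^+ (i + j) * wedge t.2 (row_mx
      (bracket A (col (lift j i) X) (col j X)) (col' i (col' j X))))).
    do 2![apply: eq_bigr => ? _]; rewrite mulr_sumr.
    by apply: eq_bigr => t _; rewrite mulrCA.
  under eq_bigr do rewrite exchange_big; rewrite exchange_big.
  apply: eq_bigr => t _; rewrite mulr_sumr.
  by apply: eq_bigr => j _; rewrite mulr_sumr.
rewrite !big_seq; apply: eq_bigr => t /ws /andP[/eqP st rt].
rewrite diff_wedge // big_flatten big_map big_filter st mulr_sumr.
rewrite 2![in LHS]big_seq_cond 2![in RHS]big_seq_cond.
apply: eq_bigr => a; rewrite mem_iota => /andP[/andP[_ ha] _].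
rewrite big_map mulr_sumr [RHS]big_mkcond; apply: eq_bigr => q _ /=.
rewrite mon_val_scale mon_val_mul rmorphXn rmorphN1.
case: ifPn => [_|nu]; first by ring.
by rewrite wedge_nuniq ?mulr0 //= size_skip st.
Qed.

(** The entries of B replace those of the environment a, which is why the
    coefficients of s are required to be constant. *)
Lemma theta_ev B a k (s : seq eterm) (X : 'M[R]_(7, k)) : wfL 7 k s ->
  all (fun t => t.1.2 == [::]) s ->
  theta B (ev a s) X = ev (ent B) (thetaL s) X.
Proof.
move=> /allP ws /allP cs; rewrite /thetaL /ev big_flatten big_map.
transitivity (\sum_(t <- s) mon_val a t.1 * theta B (wedge t.2) X).
  rewrite /theta exchange_big -sumrN; apply: eq_bigr => t _.
  by rewrite -mulr_sumr mulrN.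
rewrite !big_seq; apply: eq_bigr => t ts; have /andP[/eqP st rt] := ws t ts.
rewrite theta_wedge // big_flatten big_map st mulrN -mulrN -sumrN mulr_sumr.
apply: eq_bigr => b _; rewrite big_map -sumrN mulr_sumr.
apply: eq_bigr => q _ /=; rewrite mon_val_scale mon_val_mul.
rewrite (_ : mon_val (ent B) t.1 = mon_val a t.1); last first.
  by have /eqP h := cs t ts; rewrite /mon_val h !big_nil.
by rewrite mulrN1z; ring.
Qed.

End Evaluation.

(** * The forms of the G2-structure *)

Definition constL (s : seq (int * seq nat)) : seq eterm :=
  [seq ((t.1, [::]), t.2) | t <- s].

Definition omegaL : seq eterm :=
  constL [:: (1, [:: 1; 2]%N); (1, [:: 3; 4]%N); (1, [:: 5; 6]%N)].
Definition rhoL : seq eterm :=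
  constL [:: (1, [:: 1; 3; 5]%N); (-1, [:: 1; 4; 6]%N);
             (-1, [:: 2; 4; 5]%N); (-1, [:: 2; 3; 6]%N)].
Definition phiL : seq eterm := [seq (t.1, rcons t.2 7%N) | t <- omegaL] ++ rhoL.
Definition psiL : seq eterm := hodgeL phiL.

(** As psi is closed and * psi = phi, its Laplacian is d * d phi. *)
Definition lapL : seq eterm := diffL (hodgeL (diffL phiL)).

Section Forms.
Variable R : realType.
Implicit Types (a : nat -> nat -> R) (A : 'M[R]_6).

Lemma rho_plus_ev a (X : 'M[R]_(6, 3)) : rho_plus X = ev a rhoL X.
Proof.
rewrite /rho_plus !eform_wedge /ev /rhoL /constL !big_cons big_nil /=.
rewrite /mon_val !big_nil /=; ring.
Qed.

Lemma wedge_usubmx k K (X : 'M[R]_(7, k)) : size K = k -> in_range 6 K ->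
  wedge K (usubmx (X : 'M_(6 + 1, k))) = wedge K X.
Proof.
move=> sK /allP rK; congr (\det _); apply/matrixP => i j.
by rewrite !mxE -!/(idx _) idx_lshift // rK ?mem_nth ?sK.
Qed.

Lemma phi_ev a (X : 'M[R]_(7, 3)) : phi X = ev a phiL X.
Proof.
rewrite /phi (rho_plus_ev a) !eform_wedge /ev /phiL /rhoL /omegaL /constL /=.
rewrite !big_cons !big_nil /= !wedge_usubmx //.
rewrite /mon_val !big_nil /=; ring.
Qed.

Lemma psi_ev a (X : 'M[R]_(7, 4)) : psi X = ev a psiL X.
Proof.
by rewrite /psi (hodge_ext _ _ (phi_ev a)) hodge_ev.
Qed.

Lemma hodge0 k l (kl : (k + l = 7)%N) (f : Defs.form R 7 k) Y :
  (forall X, f X = 0) -> hodge kl f Y = 0.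
Proof. by move=> f0; rewrite /hodge big1 ?mulr0 // => I _; rewrite f0 mul0r. Qed.

Lemma diff0 A k (f : Defs.form R 7 k.+1) X :
  (forall Y, f Y = 0) -> diff A f X = 0.
Proof. by move=> f0; do 2![rewrite /diff big1 // => ? _]; rewrite f0 mulr0. Qed.

Lemma codiff_psi A (X : 'M[R]_(7, 3)) :
  codiff A (erefl : (4 + 3 = 7)%N) (erefl : (4 + 3 = 7)%N) psi X =
  ev (ent A) (hodgeL (diffL phiL)) X.
Proof.
rewrite /codiff (_ : (-1) ^+ 4 = 1) ?mul1r; last by rewrite -signr_odd.
have hpsi Y : hodge (erefl : (4 + 3 = 7)%N) psi Y = ev (ent A) phiL Y.
  by rewrite (hodge_ext _ _ (psi_ev (ent A))) hodge_ev.
have dphi Y : diff A (hodge (erefl : (4 + 3 = 7)%N) psi) Y =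
    ev (ent A) (diffL phiL) Y.
  by rewrite (diff_ext _ _ hpsi) diff_ev.
by rewrite (hodge_ext _ _ dphi) hodge_ev; [|vm_compute|vm_compute].
Qed.

Lemma laplacian_psi A (X : 'M[R]_(7, 4)) :
  coclosed A -> laplacian A psi X = ev (ent A) lapL X.
Proof.
move=> cA; rewrite /laplacian (diff_ext _ _ (codiff_psi A)).
rewrite diff_ev; last by vm_compute.
rewrite [X in _ + X](_ : _ = 0) ?addr0 //.
rewrite /codiff hodge0 ?mulr0 // => Y; apply: diff0 => Z; apply: hodge0; exact: cA.
Qed.

Lemma theta_psi B (X : 'M[R]_(7, 4)) : theta B psi X = ev (ent B) (thetaL psiL) X.
Proof.
rewrite -(theta_ev B (ent B)) //; congr (- _).
by apply: eq_bigr => i _; rewrite (psi_ev (ent B)).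
Qed.

End Forms.

(** * Coclosed structures *)

Ltac expand_coef H :=
  match type of H with context [coefL ?I ?l] =>
    let v := eval vm_compute in (coefL I l) in
    replace (coefL I l) with v in H by (vm_compute; reflexivity)
  end;
  rewrite /poly_val /mon_val unlock /= in H.

Local Notation "a _[ i , j ]" := (a i%N j%N)
  (at level 2, left associativity, format "a _[ i ,  j ]").

Section Coclosed.
Variable R : realType.
Implicit Types (a : nat -> nat -> R).

(** The equations A J + J A^t = 0, solved for 15 of the 36 entries. *)
Record sp_env a : Prop := SpEnv {
  sp22 : a _[2, 2] = - a _[1, 1];
  sp44 : a _[4, 4] = - a _[3, 3];
  sp66 : a _[6, 6] = - a _[5, 5];
  sp31 : a _[3, 1] = - a _[2, 4];
  sp32 : a _[3, 2] = a _[1, 4];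
  sp41 : a _[4, 1] = a _[2, 3];
  sp42 : a _[4, 2] = - a _[1, 3];
  sp51 : a _[5, 1] = - a _[2, 6];
  sp52 : a _[5, 2] = a _[1, 6];
  sp61 : a _[6, 1] = a _[2, 5];
  sp62 : a _[6, 2] = - a _[1, 5];
  sp53 : a _[5, 3] = - a _[4, 6];
  sp54 : a _[5, 4] = a _[3, 6];
  sp63 : a _[6, 3] = a _[4, 5];
  sp64 : a _[6, 4] = - a _[3, 5] }.

Lemma coclosed_sp a :
  (forall I, size I = 5%N -> in_range 7 I ->
    poly_val a (coefL I (diffL psiL)) = 0) -> sp_env a.
Proof.
move=> H.
have H1 := H [:: 1; 2; 3; 4; 7]%N erefl isT; expand_coef H1.
have H2 := H [:: 1; 2; 5; 6; 7]%N erefl isT; expand_coef H2.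
have H3 := H [:: 3; 4; 5; 6; 7]%N erefl isT; expand_coef H3.
(* The first three coefficients are the sums of two of the traces a_11 + a_22,
   a_33 + a_44 and a_55 + a_66, up to sign. *)
split; try lra.
- have H4 := H [:: 1; 4; 5; 6; 7]%N erefl isT; expand_coef H4; lra.
- have H4 := H [:: 2; 4; 5; 6; 7]%N erefl isT; expand_coef H4; lra.
- have H4 := H [:: 1; 3; 5; 6; 7]%N erefl isT; expand_coef H4; lra.
- have H4 := H [:: 2; 3; 5; 6; 7]%N erefl isT; expand_coef H4; lra.
- have H4 := H [:: 1; 3; 4; 6; 7]%N erefl isT; expand_coef H4; lra.
- have H4 := H [:: 2; 3; 4; 6; 7]%N erefl isT; expand_coef H4; lra.
- have H4 := H [:: 1; 3; 4; 5; 7]%N erefl isT; expand_coef H4; lra.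
- have H4 := H [:: 2; 3; 4; 5; 7]%N erefl isT; expand_coef H4; lra.
- have H4 := H [:: 1; 2; 3; 6; 7]%N erefl isT; expand_coef H4; lra.
- have H4 := H [:: 1; 2; 4; 6; 7]%N erefl isT; expand_coef H4; lra.
- have H4 := H [:: 1; 2; 3; 5; 7]%N erefl isT; expand_coef H4; lra.
- have H4 := H [:: 1; 2; 4; 5; 7]%N erefl isT; expand_coef H4; lra.
Qed.

Lemma coclosed_sp_env A : coclosed A -> sp_env (ent A).
Proof.
move=> cA; apply: coclosed_sp => I sI rI.
have wd : wfL 7 5 (diffL psiL) by vm_compute.
have wp : wfL 7 4 psiL by vm_compute.
rewrite -(ev_basis _ wd sI rI) -(diff_ev _ _ wp).
by rewrite -(diff_ext _ _ (psi_ev (ent A))) cA.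
Qed.

End Coclosed.

(** * Derivations *)

Section Derivations.
Variable R : realType.
Implicit Types (A M : 'M[R]_6) (D : 'M[R]_7).

Definition hblock (D : 'M[R]_7) : 'M[R]_6 := ulsubmx (D : 'M_(6 + 1)).
Definition diag_sum M (q : R) : 'M[R]_7 := block_mx M 0 0 (q%:M : 'M_1).

Lemma ord_max7 : (ord_max : 'I_7) = rshift 6 (0 : 'I_1).
Proof. exact: val_inj. Qed.

Lemma bracketE A (x y : 'cV[R]_6) (s t : R) :
  bracket A (col_mx x s%:M) (col_mx y t%:M) =
  col_mx (s *: (A *m y) - t *: (A *m x)) 0.
Proof.
by rewrite /bracket ord_max7 !(@col_mxEd _ 6 1) !col_mxKu !mxE !mulr1n.
Qed.

Lemma col7_split (x : 'cV[R]_7) :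
  exists (y : 'cV[R]_6) (t : R), x = col_mx y t%:M.
Proof.
exists (usubmx (x : 'cV_(6 + 1))), (dsubmx (x : 'cV_(6 + 1)) 0 0).
by rewrite -[LHS](@vsubmxK _ 6 1) -mx11_scalar.
Qed.

(** The h-component of the derivation identity on a pair (e_7, y), y in h. *)
Lemma derivation_hblock A (D : 'M[R]_7) : derivation A D ->
  commutator (hblock D) A = D ord_max ord_max *: A.
Proof.
move=> dD; set d := D _ _; suff h (y : 'cV[R]_6) :
    hblock D *m (A *m y) = d *: (A *m y) + A *m (hblock D *m y).
  apply/matrixP => i j; have := h (delta_mx j 0).
  rewrite !mulmxA -!colE => /matrixP/(_ i 0); rewrite !mxE => ->.
  by rewrite addrK.
pose e7 : 'cV[R]_7 := col_mx (0 : 'cV_6) (1%:M : 'cV_1).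
pose yy : 'cV[R]_7 := col_mx y (0%:M : 'cV_1).
have eD : D = block_mx (hblock D) (ursubmx (D : 'M_(6 + 1)))
                       (dlsubmx (D : 'M_(6 + 1))) (d%:M : 'M_1).
  suff <- : drsubmx (D : 'M_(6 + 1)) = d%:M by exact/esym/(@submxK _ 6 1 6 1).
  by rewrite [LHS]mx11_scalar /d ord_max7 !mxE.
have e := dD e7 yy; rewrite /e7 /yy bracketE eD in e; move: e.
rewrite !(@mul_block_col R 6 1 6 1 1) !mulmx0 !mulmx1 !mul_mx_scalar !add0r.
rewrite !scale0r !addr0 !subr0 !scale1r.
rewrite (@mx11_scalar R (dlsubmx _ *m y)) !bracketE scale0r scale1r subr0.
rewrite mulmx0 scaler0 subr0 (@add_col_mx R 6 1 1).
by move/(@eq_col_mx _ 6 1) => [].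
Qed.

Lemma derivation_diag_sum A M (d : R) :
  commutator M A = d *: A -> derivation A (diag_sum M d).
Proof.
move=> e x y; have em (z : 'cV[R]_6) :
    M *m (A *m z) = A *m (M *m z) + d *: (A *m z).
  by rewrite [d *: _]scalemxAl -e mulmxBl !mulmxA addrC subrK.
have [x' [s ->]] := col7_split x; have [y' [t ->]] := col7_split y.
rewrite /diag_sum bracketE !(@mul_block_col R 6 1 6 1 1) !mul0mx.
rewrite !addr0 !add0r mulmx0 -!scalar_mxM !bracketE (@add_col_mx R 6 1 1) addr0.
rewrite mulmxBr -!scalemxAr !em !scalerDr !scalerA opprD [s * d]mulrC [t * d]mulrC.
by rewrite [X in X + _]addrC addrACA.
Qed.

Lemma commutatorD M N A : commutator (M + N) A = commutator M A + commutator N A.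
Proof. by rewrite /commutator mulmxDl mulmxDr opprD addrACA. Qed.

Lemma commutatorZ (a : R) M A : commutator (a *: M) A = a *: commutator M A.
Proof. by rewrite /commutator -scalemxAl -scalemxAr scalerBr. Qed.

Lemma commutator_scalar (a : R) A : commutator a%:M A = 0.
Proof. by rewrite /commutator scalar_mxC subrr. Qed.

(** The adjoint of ad(A) for the trace form is ad(A^t). *)
Lemma inner_commutator M A :
  inner (commutator M A) A = inner M (commutator A A^T).
Proof.
rewrite /inner /commutator linearB /= !trmx_mul !trmxK.
rewrite mulmxBl mulmxBr !linearB /= -!mulmxA.
by rewrite [\tr (A *m _)]mxtrace_mulC -mulmxA.
Qed.

Lemma innerD M N P : inner (M + N) P = inner M P + inner N P.
Proof. by rewrite /inner mulmxDl linearD. Qed.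

Lemma innerZ (a : R) M P : inner (a *: M) P = a * inner M P.
Proof. by rewrite /inner -scalemxAl linearZ. Qed.

Lemma inner_tr M P : inner M^T P = inner M P^T.
Proof. by rewrite /inner -mxtrace_tr trmx_mul !trmxK mxtrace_mulC. Qed.

Lemma commutator_tr A : (commutator A A^T)^T = commutator A A^T.
Proof. by rewrite /commutator linearB /= !trmx_mul !trmxK. Qed.

Lemma inner_scalar_commutator (a : R) A : inner a%:M (commutator A A^T) = 0.
Proof. by rewrite -inner_commutator commutator_scalar /inner mul0mx linear0. Qed.

Lemma normsq_neq0 A : A != 0 -> normsq A != 0.
Proof.
apply: contraNneq; rewrite /normsq /inner /mxtrace => h.
have e i j : A i j ^+ 2 = 0.
  have h1 k : 0 <= (A *m A^T) k k.
    by rewrite mxE sumr_ge0 // => l _; rewrite mxE -expr2 sqr_ge0.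
  have : (A *m A^T) i i = 0 by apply: (psumr_eq0P _ h).
  rewrite mxE => h2; have : A i j * A^T j i = 0.
    by apply: (psumr_eq0P _ h2) => // l _; rewrite mxE -expr2 sqr_ge0.
  by rewrite mxE expr2.
by apply/eqP/matrixP => i j; rewrite mxE; apply/eqP; rewrite -sqrf_eq0 e.
Qed.

Lemma hblockD D E : hblock (D + E) = hblock D + hblock E.
Proof. by apply/matrixP => i j; rewrite !mxE. Qed.

Lemma hblockZ (a : R) D : hblock (a *: D) = a *: hblock D.
Proof. by apply/matrixP => i j; rewrite !mxE. Qed.

Lemma hblock_tr D : hblock D^T = (hblock D)^T.
Proof. by apply/matrixP => i j; rewrite !mxE. Qed.

Lemma hblock_scalar (a : R) : hblock a%:M = a%:M.
Proof. by apply/matrixP => i j; rewrite !mxE (inj_eq (@lshift_inj 6 1)). Qed.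

Lemma hblock_diag_sum M (q : R) : hblock (diag_sum M q) = M.
Proof. exact: (@block_mxKul _ 6 1 6 1). Qed.

Lemma diag_sum_max M (q : R) : diag_sum M q ord_max ord_max = q.
Proof. by rewrite ord_max7 /diag_sum (@block_mxEdr _ 6 1 6 1) mxE. Qed.

Lemma diag_sum_tr M (q : R) : (diag_sum M q)^T = diag_sum M^T q.
Proof. by rewrite /diag_sum (@tr_block_mx _ 6 1 6 1) !trmx0 tr_scalar_mx. Qed.

Lemma diag_sumD M N (q r : R) :
  diag_sum M q + diag_sum N r = diag_sum (M + N) (q + r).
Proof.
by rewrite /diag_sum (@add_block_mx _ 6 1 6 1) !addr0 raddfD.
Qed.

Lemma diag_sumZ M (a q : R) : a *: diag_sum M q = diag_sum (a *: M) (a * q).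
Proof.
by rewrite /diag_sum (@scale_block_mx _ 6 1 6 1) !scaler0 scale_scalar_mx.
Qed.

Lemma scalar_diag_sum (a : R) : a%:M = diag_sum a%:M a.
Proof. by rewrite /diag_sum -(@scalar_mx_block _ 6 1). Qed.

(** Pair the equation with A. *)
Lemma commutator_delta A M (d : R) : A != 0 ->
  commutator M A = d *: A -> d = inner M (commutator A A^T) / normsq A.
Proof.
move=> A0 e; rewrite -inner_commutator e innerZ -/(normsq A) mulfK //.
exact: normsq_neq0.
Qed.

End Derivations.

(** * The endomorphism Q_A *)

Definition rho_coefL (I : seq nat) : int :=
  kron [:: 1; 3; 5]%N I - kron [:: 1; 4; 6]%N I
  - kron [:: 2; 4; 5]%N I - kron [:: 2; 3; 6]%N I.

Definition rho_pairs (i : nat) : seq (nat * nat) :=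
  [seq mp <- [seq (m, p) | m <- iota 1 6, p <- iota 1 6] |
    rho_coefL [:: mp.1; mp.2; i] != 0].

Definition circ6L (i j : nat) : seq monomial :=
  [seq (rho_coefL [:: mp.1; mp.2; i] * rho_coefL [:: nq.1; nq.2; j],
        [:: (mp.1, nq.1); (mp.2, nq.2)])
    | mp <- rho_pairs i, nq <- rho_pairs j].

Definition increasing_lists (n k : nat) : seq (seq nat) :=
  iter k (fun s => [seq K <- allpairs (fun K i => rcons K i) s (iota 1 n) |
                     sorted ltn K]) [:: [::]].

Ltac compute_list t :=
  let v := eval vm_compute in t in
  replace t with v by (vm_compute; reflexivity).

Ltac compute_lists :=
  repeat match goal with
  | |- context [coefL ?I ?l] => compute_list (coefL I l)
  end;
  rewrite /poly_val /mon_val unlock /=.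

Section QA.
Variable R : realType.
Implicit Types (a : nat -> nat -> R) (A : 'M[R]_6).

Lemma rho_plus_coefE i j k : (0 < i <= 6)%N -> (0 < j <= 6)%N ->
  (0 < k <= 6)%N ->
  rho_plus_coef R (idx i) (idx j) (idx k) = (rho_coefL [:: i; j; k])%:~R.
Proof.
move=> hi hj hk; rewrite /rho_plus_coef /rho_plus !eform_wedge.
have -> : basis_cols R (tnth [tuple idx i; idx j; idx k]) =
    basisL R (n := 5) 3 [:: i; j; k].
  by apply/matrixP => x [[|[|[|//]]] hy]; rewrite !mxE.
by rewrite !wedge_basis //= ?hi ?hj ?hk // /rho_coefL !intrB.
Qed.

Lemma sum_rho_pairs (i : nat) (F : nat -> nat -> R) :
  \sum_(mp <- rho_pairs i) (rho_coefL [:: mp.1; mp.2; i])%:~R * F mp.1 mp.2 =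
  \sum_(m < 6) \sum_(p < 6) (rho_coefL [:: m.+1; p.+1; i])%:~R * F m.+1 p.+1.
Proof.
rewrite big_filter big_mkcond big_allpairs sum_iota1; apply: eq_bigr => m _.
rewrite sum_iota1; apply: eq_bigr => p _ /=.
by case: eqP => // ->; rewrite mul0r.
Qed.

Lemma circ6E (S : 'M[R]_6) i j : (0 < i <= 6)%N -> (0 < j <= 6)%N ->
  ent (circ6 S) i j = poly_val (ent S) (circ6L i j).
Proof.
move=> hi hj; rewrite /poly_val big_allpairs_dep /mon_val /=.
transitivity (\sum_(mp <- rho_pairs i) (rho_coefL [:: mp.1; mp.2; i])%:~R *
  \sum_(nq <- rho_pairs j) (rho_coefL [:: nq.1; nq.2; j])%:~R *
    (ent S mp.1 nq.1 * ent S mp.2 nq.2)); last first.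
  apply: eq_bigr => mp _; rewrite mulr_sumr; apply: eq_bigr => nq _.
  by rewrite !big_cons big_nil /= intrM; ring.
rewrite (sum_rho_pairs i (fun m p => \sum_(nq <- rho_pairs j)
  (rho_coefL [:: nq.1; nq.2; j])%:~R * (ent S m nq.1 * ent S p nq.2))).
rewrite /ent mxE; apply: eq_bigr => m _; rewrite exchange_big.
apply: eq_bigr => p _; rewrite (sum_rho_pairs j (fun n q =>
  S (idx m.+1) (idx n) * S (idx p.+1) (idx q))) mulr_sumr.
apply: eq_bigr => n _; rewrite mulr_sumr; apply: eq_bigr => q _.
have h (r : 'I_6) : (0 < r.+1 <= 6)%N by rewrite ltn_ord.
have := rho_plus_coefE (h m) (h p) hi; have := rho_plus_coefE (h n) (h q) hj.
by rewrite !idxS => -> ->; ring.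
Qed.

(** Here a stands for the entries of A. The blocks of Q_A are written as
    polynomials in them, so that coefficients of forms can be compared. *)
Definition trJ a : R :=
  a _[1, 2] - a _[2, 1] + (a _[3, 4] - a _[4, 3]) + (a _[5, 6] - a _[6, 5]).

Definition sym_env a i j : R := 2^-1 * (a i j + a j i).

Definition comm_env a i j : R :=
  \sum_(q <- iota 1 6) (a i q * a j q - a q i * a q j).

Definition QA_entry77 a : R :=
  - (2^-1 * \sum_(i <- iota 1 6) \sum_(j <- iota 1 6) sym_env a i j ^+ 2)
  - 4^-1 * trJ a ^+ 2.

Definition QA_entry a i j : R :=
  if (i == 7%N) || (j == 7%N) then (if i == j then QA_entry77 a else 0) else
  2^-1 * (comm_env a i j + poly_val (sym_env a) (circ6L i j)).

Ltac solve_off_diagonal H sb sb' K0 K1 K2 K3 :=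
  match goal with
  | |- [/\ _ ?i1 ?j1 = _, _ ?i2 ?j2 = _ & _ ?i3 ?j3 = _] =>
    let h0 := fresh in let h1 := fresh in let h2 := fresh in let h3 := fresh in
    have h0 := H K0 isT; have h1 := H K1 isT;
    have h2 := H K2 isT; have h3 := H K3 isT;
    expand_coef h0; expand_coef h1; expand_coef h2; expand_coef h3;
    have := sb i1 j1 isT isT; have := sb i2 j2 isT isT;
    have := sb i3 j3 isT isT; have := sb' i1 j1 isT isT;
    have := sb' i2 j2 isT isT; have := sb' i3 j3 isT isT;
    clear -h0 h1 h2 h3; move=> *; split; lra
  end.

(** The infinitesimal stabiliser of psi consists of skew-symmetric matrices, so
    that it contains no nonzero symmetric one. In coordinates, the 28 coefficients of
    theta(B) psi at the e^I that do not occur in psi split into seven groups of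
    four; those of a group are signed sums of the same three off-diagonal
    entries of B, with four different sign patterns, which determine the
    entries. *)
Lemma theta_psi_inj (b b' : nat -> nat -> R) :
  (forall i j, (0 < i <= 7)%N -> (0 < j <= 7)%N -> b i j = b j i) ->
  (forall i j, (0 < i <= 7)%N -> (0 < j <= 7)%N -> b' i j = b' j i) ->
  (forall K, K \in increasing_lists 7 4 -> poly_val b (coefL K (thetaL psiL)) =
                                  poly_val b' (coefL K (thetaL psiL))) ->
  forall i j, (0 < i <= 7)%N -> (0 < j <= 7)%N -> b i j = b' i j.
Proof.
move=> sb sb' H.
have [e12 e34 e56] :
    [/\ b _[1, 2] = b' _[1, 2], b _[3, 4] = b' _[3, 4] & b _[5, 6] = b' _[5, 6]].
  solve_off_diagonal H sb sb'
    [:: 1; 3; 5; 7]%N [:: 1; 4; 6; 7]%N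
    [:: 2; 3; 6; 7]%N [:: 2; 4; 5; 7]%N.
have [e13 e24 e67] :
    [/\ b _[1, 3] = b' _[1, 3], b _[2, 4] = b' _[2, 4] & b _[6, 7] = b' _[6, 7]].
  solve_off_diagonal H sb sb'
    [:: 1; 2; 5; 7]%N [:: 1; 4; 5; 6]%N
    [:: 2; 3; 5; 6]%N [:: 3; 4; 5; 7]%N.
have [e14 e23 e57] :
    [/\ b _[1, 4] = b' _[1, 4], b _[2, 3] = b' _[2, 3] & b _[5, 7] = b' _[5, 7]].
  solve_off_diagonal H sb sb'
    [:: 1; 2; 6; 7]%N [:: 1; 3; 5; 6]%N
    [:: 2; 4; 5; 6]%N [:: 3; 4; 6; 7]%N.
have [e15 e26 e47] :
    [/\ b _[1, 5] = b' _[1, 5], b _[2, 6] = b' _[2, 6] & b _[4, 7] = b' _[4, 7]].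
  solve_off_diagonal H sb sb'
    [:: 1; 2; 3; 7]%N [:: 1; 3; 4; 6]%N
    [:: 2; 3; 4; 5]%N [:: 3; 5; 6; 7]%N.
have [e16 e25 e37] :
    [/\ b _[1, 6] = b' _[1, 6], b _[2, 5] = b' _[2, 5] & b _[3, 7] = b' _[3, 7]].
  solve_off_diagonal H sb sb'
    [:: 1; 2; 4; 7]%N [:: 1; 3; 4; 5]%N
    [:: 2; 3; 4; 6]%N [:: 4; 5; 6; 7]%N.
have [e17 e36 e45] :
    [/\ b _[1, 7] = b' _[1, 7], b _[3, 6] = b' _[3, 6] & b _[4, 5] = b' _[4, 5]].
  solve_off_diagonal H sb sb'
    [:: 1; 2; 3; 5]%N [:: 1; 2; 4; 6]%N
    [:: 2; 3; 4; 7]%N [:: 2; 5; 6; 7]%N.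
have [e27 e35 e46] :
    [/\ b _[2, 7] = b' _[2, 7], b _[3, 5] = b' _[3, 5] & b _[4, 6] = b' _[4, 6]].
  solve_off_diagonal H sb sb'
    [:: 1; 2; 3; 6]%N [:: 1; 2; 4; 5]%N
    [:: 1; 3; 4; 7]%N [:: 1; 5; 6; 7]%N.
(* The seven remaining coefficients only involve the diagonal. *)
have h0 := H [:: 1; 2; 3; 4]%N isT; expand_coef h0.
have h1 := H [:: 1; 2; 5; 6]%N isT; expand_coef h1.
have h2 := H [:: 1; 3; 6; 7]%N isT; expand_coef h2.
have h3 := H [:: 1; 4; 5; 7]%N isT; expand_coef h3.
have h4 := H [:: 2; 3; 5; 7]%N isT; expand_coef h4.
have h5 := H [:: 2; 4; 6; 7]%N isT; expand_coef h5.
have h6 := H [:: 3; 4; 5; 6]%N isT; expand_coef h6.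
have [e11 e22 e33 e44] : [/\ b _[1, 1] = b' _[1, 1], b _[2, 2] = b' _[2, 2],
    b _[3, 3] = b' _[3, 3] & b _[4, 4] = b' _[4, 4]] by split; lra.
have [e55 e66 e77] : [/\ b _[5, 5] = b' _[5, 5], b _[6, 6] = b' _[6, 6] &
    b _[7, 7] = b' _[7, 7]] by split; lra.
clear H; do 2!case=> [|[|[|[|[|[|[|[|//]]]]]]]]; move=> // _ _;
  first [assumption | rewrite sb // sb' //; assumption].
Qed.

Ltac expand_QA :=
  rewrite /QA_entry /=;
  repeat match goal with
  | |- context [circ6L ?i ?j] => compute_list (circ6L i j)
  end;
  rewrite /poly_val /mon_val /comm_env /QA_entry77 /sym_env /trJ unlock /=.

Ltac check_QA := compute_lists; expand_QA;
  repeat match goal with H : _ = _ |- _ => rewrite H; clear H end; by field.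

(** The identity between the Laplacian of psi and theta(Q_A) psi, explained at
    the beginning of the file, as 35 polynomial identities in the 21 free entries
    of A. *)
Lemma QA_laplacian a : sp_env a -> forall K, K \in increasing_lists 7 4 ->
  poly_val (QA_entry a) (coefL K (thetaL psiL)) = poly_val a (coefL K lapL).
Proof.
move=> spa K; compute_list (increasing_lists 7 4).
rewrite !inE; repeat case/orP; move/eqP->; case: spa => *; check_QA.
Qed.

Lemma increasing_listsP K : K \in increasing_lists 7 4 -> size K = 4%N /\ in_range 7 K.
Proof.
move=> hK; suff: all (fun K => (size K == 4%N) && in_range 7 K) (increasing_lists 7 4).
  by move/allP/(_ _ hK)/andP=> [/eqP].
by vm_compute.
Qed.

Lemma QA_coef A Q K : coclosed A -> is_QA A Q -> K \in increasing_lists 7 4 ->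
  poly_val (ent Q) (coefL K (thetaL psiL)) =
  poly_val (QA_entry (ent A)) (coefL K (thetaL psiL)).
Proof.
move=> cA [_ QE] hK; have [sK rK] := increasing_listsP hK.
rewrite (QA_laplacian (coclosed_sp_env cA) hK).
have wl : wfL 7 4 lapL by vm_compute.
have wt : wfL 7 4 (thetaL psiL) by vm_compute.
rewrite -(ev_basis _ wl sK rK) -(ev_basis _ wt sK rK).
by rewrite -(laplacian_psi _ cA) QE theta_psi.
Qed.

Lemma ent_symp A i j : ent (symp A) i j = sym_env (ent A) i j.
Proof. by rewrite /ent /symp /sym_env !mxE. Qed.

Lemma ent_commutator A i j : ent (commutator A A^T) i j = comm_env (ent A) i j.
Proof.
rewrite /ent /comm_env sum_iota1 !mxE -sumrB; apply: eq_bigr => q _.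
by rewrite !mxE /ent idxS.
Qed.

Lemma poly_val_ext (a b : nat -> nat -> R) (s : seq monomial) :
  (forall i j, a i j = b i j) -> poly_val a s = poly_val b s.
Proof.
move=> ab; apply: eq_bigr => u _; congr (_ * _).
by apply: eq_bigr => p _; rewrite ab.
Qed.

Definition QA_hblock A : 'M[R]_6 :=
  2^-1 *: (commutator A A^T + circ6 (symp A)).

Lemma ent_QA_hblock A i j : (0 < i <= 6)%N -> (0 < j <= 6)%N ->
  ent (QA_hblock A) i j = QA_entry (ent A) i j.
Proof.
move=> hi hj; rewrite /QA_entry ifF; last by apply/negbTE; lia.
rewrite -ent_commutator -(poly_val_ext _ (ent_symp A)) -circ6E //.
by rewrite /ent !mxE.
Qed.

Lemma circ6_tr (S : 'M[R]_6) : S^T = S -> (circ6 S)^T = circ6 S.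
Proof.
move=> sS; have sE i j : S i j = S j i by rewrite -{1}sS mxE.
apply/matrixP => i j; rewrite !mxE exchange_big; apply: eq_bigr => m _.
apply: eq_bigr => n _; rewrite exchange_big; apply: eq_bigr => p _.
apply: eq_bigr => q _; rewrite [S n m]sE [S q p]sE; ring.
Qed.

Lemma symp_tr A : (symp A)^T = symp A.
Proof. by rewrite /symp linearZ linearD /= trmxK addrC. Qed.

Lemma QA_hblock_tr A : (QA_hblock A)^T = QA_hblock A.
Proof.
by rewrite /QA_hblock linearZ linearD /= commutator_tr circ6_tr ?symp_tr.
Qed.

Lemma ent_tr n (M : 'M[R]_n.+1) i j : ent M^T i j = ent M j i.
Proof. by rewrite /ent mxE. Qed.

Lemma QA_sym A i j : (0 < i <= 7)%N -> (0 < j <= 7)%N ->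
  QA_entry (ent A) i j = QA_entry (ent A) j i.
Proof.
move=> hi hj; have [i7|i7] := eqVneq i 7%N.
  by rewrite /QA_entry i7 eqxx /= orbT eq_sym.
have [j7|j7] := eqVneq j 7%N.
  by rewrite /QA_entry j7 eqxx /= orbT eq_sym.
by rewrite -!ent_QA_hblock; [rewrite -ent_tr QA_hblock_tr|lia..].
Qed.

Definition QA_corner A : R :=
  - (2^-1 * \tr (symp A *m symp A)) - 4^-1 * (\tr (J *m A)) ^+ 2.

Lemma trJE A : \tr (J *m A) = trJ (ent A).
Proof.
have JE i j : (0 < i <= 6)%N -> (0 < j <= 6)%N -> ent J i j =
    (kron [:: 1; 2]%N [:: j; i] + kron [:: 3; 4]%N [:: j; i]
     + kron [:: 5; 6]%N [:: j; i])%:~R :> R.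
  move=> hi hj; rewrite /ent mxE /omega !eform_wedge.
  have -> : basis_cols R (tnth [tuple idx j; idx i]) =
    basisL R (n := 5) 2 [:: j; i].
    by apply/matrixP => x [[|[|//]] hy]; rewrite !mxE.
  by rewrite !wedge_basis //= ?hi ?hj // !intrD.
have -> : \tr (J *m A) =
    \sum_(i <- iota 1 6) \sum_(j <- iota 1 6) ent J i j * ent A j i.
  rewrite sum_iota1; apply: eq_bigr => i _; rewrite sum_iota1 mxE.
  by apply: eq_bigr => j _; rewrite /ent !idxS.
rewrite unlock /= !JE //= /trJ; ring.
Qed.

Lemma QA_cornerE A : QA_corner A = QA_entry (ent A) 7%N 7%N.
Proof.
rewrite /QA_corner /QA_entry eqxx /= /QA_entry77 trJE; congr (- (_ * _) - _).
rewrite sum_iota1; apply: eq_bigr => i _; rewrite sum_iota1 mxE.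
apply: eq_bigr => j _; rewrite -ent_symp /ent !idxS expr2.
by congr (_ * _); rewrite -[in LHS]symp_tr [LHS]mxE.
Qed.

(** Q and the block matrix act on psi in the same way, both giving the Laplacian
    of psi, and both are symmetric. *)
Lemma QA_block A Q : coclosed A -> is_QA A Q ->
  Q = diag_sum (QA_hblock A) (QA_corner A).
Proof.
move=> cA QA_Q; have [sQ _] := QA_Q.
have e i j : (0 < i <= 7)%N -> (0 < j <= 7)%N -> ent Q i j = QA_entry (ent A) i j.
  apply: theta_psi_inj => [k l _ _|k l hk hl|K hK]; last exact: QA_coef.
    by rewrite -ent_tr sQ.
  exact: QA_sym.
have h (i : 'I_7) : (0 < i.+1 <= 7)%N by rewrite ltn_ord.
have h6 (i : 'I_6) : (0 < i.+1 <= 6)%N by rewrite ltn_ord.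
have n7 (i : 'I_6) : (i.+1 == 7%N) = false.
  by apply/negbTE; rewrite neq_ltn ltnS ltn_ord.
apply/matrixP => i j; have := e _ _ (h i) (h j); rewrite {1}/ent !idxS => ->.
case: (@split_ordP 6 1 i) => i' ->; case: (@split_ordP 6 1 j) => j' -> /=.
- by rewrite (@block_mxEul _ 6 1 6 1) -ent_QA_hblock // /ent !idxS.
- by rewrite (@block_mxEur _ 6 1 6 1) [j']ord1 mxE /QA_entry n7.
- by rewrite (@block_mxEdl _ 6 1 6 1) [i']ord1 mxE /QA_entry [_ == j'.+1]eq_sym n7.
- by rewrite (@block_mxEdr _ 6 1 6 1) [i']ord1 [j']ord1 mxE -QA_cornerE.
Qed.

End QA.

(** * Solitons *)

Theorem theorem4p3 (R : realType) (A : 'M[R]_6) (Q : 'M[R]_7)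
    (A_neq0 : A != 0) (A_coclosed : coclosed A) (Q_def : is_QA A Q) :
  let S := symp A in
  let L := commutator A A^T in
  let c := soliton_const A in
  let d := (normsq L + inner (circ6 S) L) / (2 * normsq A) in
  ((algebraic_soliton A Q <->
      commutator (L + circ6 S) A =
      ((normsq L + inner (circ6 S) L) / normsq A) *: A)
   /\ (algebraic_soliton A Q -> derivation A (Q - c%:M)))
  /\
  ((semi_algebraic_soliton A Q <->
      exists D1 : 'M[R]_6,
        commutator D1 A = d *: A /\
        L + circ6 S =
          - (\tr (S *m S) + 2^-1 * (\tr (J *m A)) ^+ 2 + 2 * d)%:M
          + D1 + D1^T)
   /\ (semi_algebraic_soliton A Q ->
       exists D : 'M[R]_7,
         derivation A D /\ Q = c%:M + 2^-1 *: (D + D^T))).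
Proof.
move=> S L c d.
have nA := normsq_neq0 A_neq0.
have eQ := QA_block A_coclosed Q_def.
set M := QA_hblock A in eQ; set q := QA_corner A in eQ.
have eM : L + circ6 S = 2 *: M.
  by rewrite /M /QA_hblock scalerA divff ?scale1r ?pnatr_eq0.
have eq7 : \tr (S *m S) + 2^-1 * (\tr (J *m A)) ^+ 2 = - (2 * q).
  by rewrite /q /QA_corner -/S; field.
have eMd : inner M L / normsq A = d.
  rewrite /M /QA_hblock innerZ innerD -/L -/S /d -[inner L L]/(normsq L).
  by field.
have ec : c = q - d.
  by rewrite /c /soliton_const -/S -/L eq7 /d; field.
(* The constant and the corner of D are forced by the soliton equation. *)
have soliton_blocks c' D : derivation A D -> Q = c'%:M + 2^-1 *: (D + D^T) ->
    let D1 := hblock D in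
    [/\ commutator D1 A = d *: A, M = c'%:M + 2^-1 *: (D1 + D1^T),
        D ord_max ord_max = d & c' = c].
  move=> dD eQD; have cD := derivation_hblock dD.
  have eh : M = c'%:M + 2^-1 *: (hblock D + (hblock D)^T).
    by rewrite -(hblock_diag_sum M q) -eQ eQD hblockD hblockZ hblockD
      hblock_scalar hblock_tr.
  have ed : D ord_max ord_max = d.
    rewrite (commutator_delta A_neq0 cD) -eMd eh innerD inner_scalar_commutator.
    rewrite innerZ innerD inner_tr commutator_tr -/L; by field.
  split=> //; first by rewrite cD ed.
  have := congr1 (fun N : 'M_7 => N ord_max ord_max) eQD.
  rewrite eQ diag_sum_max !mxE eqxx mulr1n ed ec => ->.
  by field.
have eQc : Q - c%:M = diag_sum (M - c%:M) d.
  rewrite eQ scalar_diag_sum -[- _]scaleN1r diag_sumZ diag_sumD scaleN1r ec.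
  by congr diag_sum; ring.
have dQc : commutator M A = d *: A -> derivation A (Q - c%:M).
  move=> e; rewrite eQc; apply: derivation_diag_sum.
  by rewrite -[- _]scaleN1r commutatorD (commutatorZ (-1)) commutator_scalar
    scaler0 addr0.
have alg_comm : algebraic_soliton A Q -> commutator M A = d *: A.
  case=> c' [D [dD dDt eQD]].
  have [h1 -> _ _] := soliton_blocks _ _ dD eQD.
  have eQDt : Q = c'%:M + 2^-1 *: (D^T + D^T^T) by rewrite trmxK [_ + D]addrC.
  have [h2 _ _ _] := soliton_blocks _ _ dDt eQDt.
  rewrite hblock_tr in h2.
  rewrite commutatorD commutator_scalar commutatorZ commutatorD h1 h2 add0r.
  by rewrite -mulr2n -scaler_nat !scalerA; congr (_ *: _); field.
have e2d : (normsq L + inner (circ6 S) L) / normsq A = 2 * d.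
  by rewrite /d; field.
split; split.
- rewrite eM commutatorZ e2d; split=> [h|].
    by rewrite (alg_comm h) scalerA.
  rewrite -scalerA => /(scalerI _) h.
  have {}h : commutator M A = d *: A by apply: h; rewrite pnatr_eq0.
  exists c, (Q - c%:M); have sQ : (Q - c%:M)^T = Q - c%:M.
    by rewrite linearB /= tr_scalar_mx (proj1 Q_def).
  split; rewrite ?sQ; [exact: dQc | exact: dQc |].
  rewrite -mulr2n -scaler_nat scalerA mulVf ?pnatr_eq0 // scale1r.
  by rewrite addrC subrK.
- by move/alg_comm.
- rewrite eM eq7; split=> [[c' [D [dD eQD]]]|[D1 [cD eD]]].
    have [h1 h2 h3 h4] := soliton_blocks _ _ dD eQD.
    exists (hblock D); split=> //.
    rewrite h2 scalerDr scalerA divff ?pnatr_eq0 // scale1r h4 ec addrA.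
    congr (_ + _ + _); rewrite -mul_scalar_mx -scalar_mxM -rmorphN /=.
    by congr (_%:M); ring.
  exists c, (diag_sum D1 d); split; first exact: derivation_diag_sum.
  rewrite eQ diag_sum_tr diag_sumD diag_sumZ scalar_diag_sum diag_sumD.
  congr diag_sum; last by rewrite ec; field.
  apply: (@scalerI _ _ 2); rewrite ?pnatr_eq0 //.
  rewrite eD scalerDr scalerA divff ?pnatr_eq0 // scale1r -addrA; congr (_ + _).
  rewrite -mul_scalar_mx -scalar_mxM -rmorphN ec; congr (_%:M); ring.
- case=> c' [D [dD eQD]]; exists D; split=> //.
  by have [_ _ _ <-] := soliton_blocks _ _ dD eQD.
Qed.
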